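(* Let $K$ be a field and let $\Delta$ be a $1$-dimensional simplicial complex. If $R_\Delta$ is normal, then $G_\Delta$ satisfies the odd cycle condition.
   Context: Let $\Delta$ be a simplicial complex on $[n]=\{1,\dots,n\}$ (a family of subsets of $[n]$ closed under taking subsets and containing every $\{i\}$); it is 1-dimensional if its largest faces have two elements. For $F\subseteq[n]$ put $x_F=\prod_{i\in F}x_i$ (with $x_\emptyset=1$). The toric ring is $R_\Delta=K[x_Ft : F\in\Delta]\subset K[x_1,\ldots,x_n,t]$. $G_\Delta$ is the graph (1-skeleton) on $[n]$ whose edges are the two-element faces of $\Delta$. A graph $G$ satisfies the odd cycle condition if for any two induced odd cycles $C_1$ and $C_2$ of $G$, either $C_1$ and $C_2$ have a common vertex or there exist $i\in V(C_1)$ and $j\in V(C_2)$ such that $\{i,j\}\in E(G)$. *)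

(* Defs.v *)
From mathcomp Require Import all_boot all_order all_algebra.
From mathcomp Require Import mpoly.

Set Implicit Arguments.
Unset Strict Implicit.
Unset Printing Implicit Defensive.

Import GRing.Theory.

Local Open Scope ring_scope.

Inductive gen_subalgebra (K : nzRingType) (A : algType K) (X : A -> Prop) :
    A -> Prop :=
| gen_subalgebra_in a : X a -> gen_subalgebra X a
| gen_subalgebra_scalar (c : K) : gen_subalgebra X c%:A
| gen_subalgebra_add a b :
    gen_subalgebra X a -> gen_subalgebra X b -> gen_subalgebra X (a + b)
| gen_subalgebra_mul a b :
    gen_subalgebra X a -> gen_subalgebra X b -> gen_subalgebra X (a * b).

(* For a subring S of a domain A, Frac(S) is realised as a subfield of         *)
(* Frac(A) = {fraction A}.                                                     *)
Definition in_frac_field (A : idomainType) (S : A -> Prop)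
    (z : {fraction A}) : Prop :=
  exists a b : A, [/\ S a, S b, b != 0 & z = tofrac a / tofrac b].

(* The library's integralOver needs a ring structure on a type; here S is only *)
(* a predicate, so the coefficients are taken in A and required to lie in S.   *)
Definition integral_over (A : idomainType) (S : A -> Prop)
    (z : {fraction A}) : Prop :=
  exists p : {poly A},
    [/\ p \is monic, forall i, S p`_i & root (map_poly (@tofrac A) p) z].

(* S is integrally closed in its field of fractions. *)
Definition normal_subring (A : idomainType) (S : A -> Prop) : Prop :=
  forall z : {fraction A}, in_frac_field S z -> integral_over S z ->
    exists2 a : A, S a & z = tofrac a.

Record simplicial_complex (n : nat) := SimplicialComplex {
  faces :> {set {set 'I_n}};
  face_subset : forall F H : {set 'I_n}, F \in faces -> H \subset F ->
                  H \in faces;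
  face_vertex : forall i : 'I_n, [set i] \in faces
}.

Definition one_dimensional (n : nat) (D : simplicial_complex n) : Prop :=
  (\max_(F in faces D) #|F|)%N = 2%N.

(* In K[x_1,...,x_n,t], the variable t is the last one, of index n. *)
Definition tvar (K : fieldType) (n : nat) : {mpoly K[n.+1]} := 'X_ord_max.

Definition xvar (K : fieldType) (n : nat) (i : 'I_n) : {mpoly K[n.+1]} :=
  'X_(lift ord_max i).

Definition xface (K : fieldType) (n : nat) (F : {set 'I_n}) :
    {mpoly K[n.+1]} :=
  \prod_(i in F) xvar K i.

Definition toric_ring (K : fieldType) (n : nat) (D : simplicial_complex n) :
    {mpoly K[n.+1]} -> Prop :=
  gen_subalgebra
    (fun p => exists2 F : {set 'I_n}, F \in faces D & p = xface K F * tvar K n).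

Arguments toric_ring K {n} D _.

Definition skeleton_graph (n : nat) (D : simplicial_complex n) : rel 'I_n :=
  fun i j => (i != j) && ([set i; j] \in faces D).

(* An induced cycle is given by a cyclic enumeration c of its vertices: the    *)
(* only edges between vertices of c are those joining cyclic neighbours.       *)
Definition induced_cycle (T : eqType) (e : rel T) (c : seq T) : Prop :=
  [/\ (2 < size c)%N, ucycle e c &
      {in c &, forall x y, e x y -> y = next c x \/ x = next c y}].

Definition induced_odd_cycle (T : eqType) (e : rel T) (c : seq T) : Prop :=
  induced_cycle e c /\ odd (size c).

Definition odd_cycle_condition (T : eqType) (e : rel T) : Prop :=
  forall c1 c2 : seq T, induced_odd_cycle e c1 -> induced_odd_cycle e c2 ->
    (exists2 i, i \in c1 & i \in c2) \/
    (exists i j, [/\ i \in c1, j \in c2 & e i j]).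

(* Main.v *)
Require Import Defs.
From mathcomp Require Import all_boot all_order all_algebra.
From mathcomp Require Import mpoly.
From mathcomp Require Import zify ring.

Set Implicit Arguments.
Unset Strict Implicit.
Unset Printing Implicit Defensive.

Import GRing.Theory.

Local Open Scope ring_scope.

(** Suppose [c1] and [c2] are disjoint odd cycles of the graph, of lengths
[2k + 1] and [2l + 1], with no edge joining them, and consider the monomial
[m = x_c1 x_c2 t^(k + l + 1)]. Three facts contradict normality.

- [m] lies in the fraction field: pairing off consecutive vertices of an odd
  cycle leaves one vertex over, so [x_c1 t^(k + 1)] and [x_c2 t^(l + 1)] belong
  to the toric ring [R], and [m] is their product divided by [t], which is in
  [R] as the generator of the empty face
  ([matching_toric_ring], [oddcycle_toric_ring]).
- [m] is integral over [R]: the product of the [2k + 1] edges of [c1] is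
  [x_c1^2 t^(2k + 1)], likewise for [c2], so [m^2] is in [R]
  ([cycle_toric_ring], [normal_sqr]).
- [m] is not in [R]. For a monomial with [t]-degree [d] and total degrees [a1]
  and [a2] in the vertices of [c1] and [c2], consider the inequality
  [uphalf a1 + uphalf a2 <= d]. It holds for each generator, because a face has
  at most two vertices and does not meet both cycles; it is preserved by
  products, because [uphalf] is subadditive; hence every monomial of every
  element of [R] satisfies it ([toric_ring_uphalf]). For [m] it would read
  [(k + 1) + (l + 1) <= k + l + 1]. *)

(** * Subalgebras and squares *)

Section GeneratedSubalgebra.

Variables (K : nzRingType) (A : algType K) (X : A -> Prop).

Lemma gen_subalgebra0 : gen_subalgebra X 0.
Proof. by rewrite -[0](scale0r (1 : A)); apply: gen_subalgebra_scalar. Qed.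

Lemma gen_subalgebra1 : gen_subalgebra X 1.
Proof. by rewrite -[1](scale1r (1 : A)); apply: gen_subalgebra_scalar. Qed.

Lemma gen_subalgebra_opp a : gen_subalgebra X a -> gen_subalgebra X (- a).
Proof.
move=> Xa; rewrite -mulN1r -[-1](scaleN1r (1 : A)).
by apply: gen_subalgebra_mul => //; apply: gen_subalgebra_scalar.
Qed.

End GeneratedSubalgebra.

(** An element of the ambient domain whose square lies in [S] is a root of the
monic polynomial [X^2 - m^2]. *)
Lemma normal_sqr (A : idomainType) (S : A -> Prop) (m b : A) :
  S 0 -> S 1 -> (forall a, S a -> S (- a)) -> normal_subring S ->
  b != 0 -> S b -> S (m * b) -> S (m ^+ 2) -> S m.
Proof.
move=> S0 S1 SN Snormal b0 Sb Smb Sm2.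
have [||a Sa /eqP] := Snormal (tofrac m); last by rewrite tofrac_eq => /eqP ->.
- exists (m * b), b; split=> //.
  by rewrite tofracM mulfK // tofrac_eq0.
- exists ('X^2 - (m ^+ 2)%:P); split.
  + exact: monicXnsubC.
  + move=> i; rewrite coefB coefXn coefC.
    by case: i => [|[|[|i]]] /=; rewrite ?sub0r ?subr0 ?oppr0 //; apply: SN.
  + rewrite rmorphB /= map_polyXn map_polyC /= rootE !hornerE /=.
    by rewrite -tofracXn subrr.
Qed.

(** * Monomials supported on a cycle *)

Section ToricRing.

Variables (K : fieldType) (n : nat) (D : simplicial_complex n).

Local Notation R := (toric_ring K D).
Local Notation e := (skeleton_graph D).
Local Notation x := (xvar K).
Local Notation t := (tvar K n).

Lemma tvar_toric_ring : (0 < n)%N -> R t.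
Proof.
case: n D => // n' D' _; apply: gen_subalgebra_in; exists set0.
  by apply: face_subset (face_vertex D' ord0) _; apply: sub0set.
by rewrite /xface big_set0 mul1r.
Qed.

Lemma vertex_toric_ring i : R (x i * t).
Proof.
apply: gen_subalgebra_in; exists [set i]; first exact: face_vertex.
by rewrite /xface big_set1.
Qed.

Lemma edge_toric_ring i j : e i j -> R (x i * x j * t).
Proof.
case/andP=> nij eij; apply: gen_subalgebra_in; exists [set i; j] => //.
by rewrite /xface big_setU1 ?inE // big_set1.
Qed.

(** Every other edge of the walk gives a perfect matching of its vertices, and
each edge of the matching contributes one factor [t]. *)
Lemma matching_toric_ring k s :
  size s = k.*2 -> sorted e s -> R ((\prod_(y <- s) x y) * t ^+ k).
Proof.
elim: k s => [|k IHk] [|y [|z s]] //=.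
  by rewrite big_nil mulr1 => _ _; apply: gen_subalgebra1.
case=> ss /andP[eyz pzs].
have -> : \prod_(i <- [:: y, z & s]) x i * t ^+ k.+1
        = (x y * x z * t) * (\prod_(i <- s) x i * t ^+ k).
  by rewrite !big_cons exprS; ring.
apply: gen_subalgebra_mul; first exact: edge_toric_ring.
by apply: IHk (path_sorted pzs).
Qed.

(** Product of all edges of the walk, sorted into their initial and their final
vertices; on a closed walk both families run through the same vertices. *)
Lemma walk_toric_ring y s : path e y s ->
  R ((\prod_(i <- belast y s) x i) * (\prod_(i <- s) x i) * t ^+ size s).
Proof.
elim: s y => [|z s IHs] y /=.
  by rewrite !big_nil !mulr1 => _; apply: gen_subalgebra1.
case/andP=> eyz pzs.
rewrite !big_cons exprS.
set a := \prod_(i <- belast z s) x i; set b := \prod_(i <- s) x i.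
have -> : x y * a * (x z * b) * (t * t ^+ size s)
        = (x y * x z * t) * (a * b * t ^+ size s) by ring.
by apply: gen_subalgebra_mul; [apply: edge_toric_ring | apply: IHs].
Qed.

Lemma cycle_toric_ring c :
  cycle e c -> R ((\prod_(i <- c) x i) ^+ 2 * t ^+ size c).
Proof.
case: c => [|y s] /=.
  by rewrite big_nil expr1n mulr1 => _; apply: gen_subalgebra1.
move/walk_toric_ring; rewrite belast_rcons size_rcons big_rcons /=.
by rewrite !big_cons expr2 [X in _ * X * _]mulrC.
Qed.

(** One vertex is used alone; the remaining vertices form a walk of even size and
are matched. *)
Lemma oddcycle_toric_ring c : odd (size c) -> cycle e c ->
  R ((\prod_(i <- c) x i) * t ^+ (size c)./2.+1).
Proof.
case: c => [|y s] //= /negbTE sodd cyc.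
have -> : \prod_(i <- y :: s) x i * t ^+ (uphalf (size s)).+1
        = (x y * t) * (\prod_(i <- s) x i * t ^+ (size s)./2).
  by rewrite big_cons uphalf_half sodd exprS; ring.
apply: gen_subalgebra_mul; first exact: vertex_toric_ring.
apply: matching_toric_ring; first by rewrite -[LHS]odd_double_half sodd.
by move: cyc; rewrite rcons_path => /andP[/path_sorted].
Qed.

(** * The parity obstruction *)

Definition vertex_degree (C : {set 'I_n}) (m : 'X_{1..n.+1}) : nat :=
  (\sum_(i in C) m (lift ord_max i))%N.

Definition face_monomial (F : {set 'I_n}) : 'X_{1..n.+1} :=
  (\sum_(i in F) U_(lift ord_max i))%MM.

Lemma vertex_degreeD C m1 m2 :
  vertex_degree C (m1 + m2)%MM = (vertex_degree C m1 + vertex_degree C m2)%N.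
Proof. by rewrite -big_split; apply: eq_bigr => i _; rewrite mnmDE. Qed.

Lemma vertex_degree_tpower C k : vertex_degree C (U_(ord_max) *+ k)%MM = 0%N.
Proof.
apply: big1 => i _.
by rewrite mulmnE mnm1E eq_sym -[_ == ord_max]negbK eq_sym neq_lift.
Qed.

Lemma vertex_degree_face C F : vertex_degree C (face_monomial F) = #|C :&: F|.
Proof.
rewrite -sum1_card /vertex_degree.
rewrite (eq_bigr (fun i => if i \in F then 1%N else 0%N)) => [|i _].
  by rewrite -big_mkcondr; apply: eq_bigl => i; rewrite inE.
rewrite mnm_sumE (eq_bigr (fun j => (j == i)%N : nat)) => [|j _]; last first.
  by rewrite mnm1E (inj_eq lift_inj).
have [Fi|nFi] := ifP; last first.
  by rewrite big1 // => j Fj; case: eqP Fj => // ->; rewrite nFi.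
rewrite (bigD1 i) //= eqxx big1 // => j /andP[_ /negbTE ->//].
Qed.

Lemma tdegree_face F : face_monomial F ord_max = 0%N.
Proof.
rewrite mnm_sumE big1 // => i _.
by rewrite mnm1E eq_sym -[_ == lift _ _]negbK neq_lift.
Qed.

Lemma xfaceE F : xface K F = 'X_[face_monomial F].
Proof. exact: mprodXE. Qed.

(** Each generator has [t]-degree one, so the bound assumed on faces is the
inequality for generators. It passes to sums because a monomial of a sum occurs
in a summand, and to products because [uphalf] is subadditive. *)
Lemma toric_ring_uphalf (C1 C2 : {set 'I_n}) p m :
  (forall F, F \in faces D ->
     (uphalf #|C1 :&: F| + uphalf #|C2 :&: F| <= 1)%N) ->
  R p -> m \in msupp p ->
  (uphalf (vertex_degree C1 m) + uphalf (vertex_degree C2 m) <= m ord_max)%N.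
Proof.
move=> faceC Rp; elim: Rp m => {p} [_ [F DF ->]|c|a b _ IHa _ IHb|a b _ IHa _ IHb] m.
- rewrite xfaceE -mpolyXD => /mem_msuppXP <-.
  rewrite !vertex_degreeD !vertex_degree_face mnmDE tdegree_face mnm1E eqxx.
  rewrite -[U_(_)%MM]mulm1n !vertex_degree_tpower !addn0.
  exact: faceC.
- rewrite -mul_mpolyC mulr1 msuppC; case: ifP => // _; rewrite inE => /eqP ->.
  by rewrite /vertex_degree !big1 // => i _; rewrite mnm0E.
- by move/msuppD_le; rewrite mem_cat => /orP[/IHa|/IHb].
- move/msuppM_le/allpairsP => [[m1 m2] /= [/IHa m1P /IHb m2P ->]].
  by rewrite !vertex_degreeD mnmDE; lia.
Qed.

End ToricRing.

Theorem proposition1p15 (K : fieldType) (n : nat) (D : simplicial_complex n)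
    (hdim : one_dimensional D)
    (hnormal : normal_subring (toric_ring K D)) :
  odd_cycle_condition (skeleton_graph D).
Proof.
move=> c1 c2 [[sz1 /andP[cyc1 uniq1] _] odd1] [[sz2 /andP[cyc2 uniq2] _] odd2].
have [/hasP[i]|/hasPn disj] := boolP (has (mem c1) c2).
  by move=> i2 i1; left; exists i.
have [/existsP[i /existsP[j /and3P[]]]|noedge] := boolP
    [exists i, exists j, [&& i \in c1, j \in c2 & skeleton_graph D i j]].
  by right; exists i, j.
exfalso.
set C1 := [set i in c1]; set C2 := [set i in c2].
have cardC1 : #|C1| = size c1 by rewrite cardsE (card_uniqP uniq1).
have cardC2 : #|C2| = size c2 by rewrite cardsE (card_uniqP uniq2).
have C12 : C1 :&: C2 = set0.
  apply/setP => i; rewrite !inE; apply/negP => /andP[i1 i2].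
  by have /negP[] := disj _ i2.
have faceC F : F \in faces D -> (uphalf #|C1 :&: F| + uphalf #|C2 :&: F| <= 1)%N.
  move=> DF.
  have cardF : (#|F| <= 2)%N.
    by rewrite -hdim (leq_bigmax_cond (F := fun H : {set 'I_n} => #|H|)).
  have cardI : (#|C1 :&: F| + #|C2 :&: F| <= 2)%N.
    rewrite -cardsUI -setIIl C12 set0I cards0 addn0 -setIUl.
    by apply: leq_trans cardF; apply: subset_leq_card; apply: subsetIr.
  (* With at most two vertices in all, the bound fails only if the face has one
     vertex on each cycle, and then it is an edge joining them. *)
  have [/eqP|[i]] := set_0Vmem (C1 :&: F); first by rewrite -cards_eq0; lia.
  have [/eqP|[j]] := set_0Vmem (C2 :&: F); first by rewrite -cards_eq0; lia.
  rewrite !inE => /andP[j2 jF] /andP[i1 iF]; case/negP: noedge.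
  apply/existsP; exists i; apply/existsP; exists j; rewrite i1 j2 /=.
  apply/andP; split.
    by apply: contraTneq i1 => ->; apply: disj.
  by apply: face_subset DF _; rewrite subUset !sub1set iF.
set k1 := (size c1)./2; set k2 := (size c2)./2.
set d := (k1 + k2).+1.
set m := xface K C1 * xface K C2 * tvar K n ^+ d.
have mE : m = 'X_[face_monomial C1 + face_monomial C2 + U_(ord_max) *+ d].
  by rewrite !mpolyXD -mpolyXn -!xfaceE.
have sz1E : size c1 = k1.*2.+1 by rewrite /k1; lia.
have sz2E : size c2 = k2.*2.+1 by rewrite /k2; lia.
have xface1 : xface K C1 = \prod_(i <- c1) xvar K i.
  by rewrite big_uniq //=; apply: eq_bigl => i; rewrite inE.
have xface2 : xface K C2 = \prod_(i <- c2) xvar K i.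
  by rewrite big_uniq //=; apply: eq_bigl => i; rewrite inE.
suff Rm : toric_ring K D m.
  have := toric_ring_uphalf faceC Rm; rewrite mE msuppX => /(_ _ (mem_head _ _)).
  rewrite !vertex_degreeD !vertex_degree_tpower !vertex_degree_face.
  rewrite !mnmDE !tdegree_face mulmnE mnm1E eqxx !setIid.
  by rewrite [C2 :&: _]setIC C12 cards0 cardC1 cardC2 sz1E sz2E; lia.
(* The generator t of the empty face serves as the denominator. *)
apply: (@normal_sqr _ _ _ (tvar K n)) hnormal _ _ _ _.
- exact: gen_subalgebra0.
- exact: gen_subalgebra1.
- exact: gen_subalgebra_opp.
- by rewrite -msupp_eq0 msuppX.
- by apply: tvar_toric_ring; case: (c1) sz1 => // i; case: i; lia.
- have -> : m * tvar K n = (xface K C1 * tvar K n ^+ k1.+1)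
                         * (xface K C2 * tvar K n ^+ k2.+1).
    by rewrite /m /d !exprS exprD; ring.
  by rewrite xface1 xface2; apply: gen_subalgebra_mul; apply: oddcycle_toric_ring.
- have -> : m ^+ 2 = (xface K C1 ^+ 2 * tvar K n ^+ size c1)
                   * (xface K C2 ^+ 2 * tvar K n ^+ size c2).
    by rewrite /m /d sz1E sz2E -!addnn !exprS !exprD; ring.
  by rewrite xface1 xface2; apply: gen_subalgebra_mul; apply: cycle_toric_ring.
Qed.
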